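(* Let $l:\mathbb{R}\to\mathbb{R}$ be a non-decreasing utility function, and suppose there exist $K,k>0$ such that $l$ is $K$-Lipschitz and satisfies $l(x_2)\ge l(x_1)+k(x_2-x_1)$ for every $x_1,x_2\in\mathbb{R}$ satisfying $x_2\ge x_1$. Let $X$ and $Y$ be random variables with CDFs $F_X$ and $F_Y$, respectively. Then $$|S_\alpha(X)-S_\alpha(Y)|\le \frac{K}{k}\,W_1(F_X,F_Y).$$
   Context: For a utility function $l:\mathbb{R}\to\mathbb{R}$ and a level $\alpha$, the utility-based shortfall risk (UBSR) of a random variable $X$ is $S_\alpha(X)=\inf\{\xi\in\mathbb{R}:\mathbb{E}[l(X-\xi)]\le\alpha\}$. $W_1$ is the 1-Wasserstein distance between CDFs on $\mathbb{R}$: $W_1(F_1,F_2)=\inf\int_{\mathbb{R}^2}|x-y|\,dF(x,y)$, the infimum being over all joint distributions $F$ on $\mathbb{R}^2$ with marginals $F_1,F_2$. *)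

(* Defs.v *)
From HB Require Import structures.
From mathcomp Require Import all_boot all_order all_algebra.
From mathcomp Require Import all_classical all_reals all_analysis measurable_realfun.

Set Implicit Arguments.
Unset Strict Implicit.
Unset Printing Implicit Defensive.

Import Order.TTheory GRing.Theory Num.Theory.
Import numFieldNormedType.Exports.

Local Open Scope classical_set_scope.
Local Open Scope ring_scope.

(* [inf] is the infimum in R, with default value 0 on sets that are empty or
   not bounded below. If X is integrable and l is nondecreasing, Lipschitz and
   of slope at least k > 0, the set has a real infimum ([ubsr_has_inf]). *)
Definition ubsr (d : measure_display) (T : measurableType d) (R : realType)
    (P : probability T R) (l : R -> R) (alpha : R) (X : {RV P >-> R}) : R :=
  inf [set xi : R | ('E_P[fun w => l (X w - xi)%R] <= alpha%:E)%E].

(* A joint distribution on R^2 is a probability measure pi on R * R; its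
   marginal CDFs are x |-> pi(]-oo, x] x R) and y |-> pi(R x ]-oo, y]). *)
Definition joint_distributions (R : realType) (F1 F2 : R -> \bar R) :
    set (probability (R * R)%type R) :=
  [set pi | (forall x : R, pi (`]-oo, x] `*` setT) = F1 x) /\
            (forall y : R, pi (setT `*` `]-oo, y]) = F2 y)].

Definition wasserstein1 (R : realType) (F1 F2 : R -> \bar R) : \bar R :=
  ereal_inf [set (\int[pi]_z (`|z.1 - z.2|)%:E)%E
            | pi in joint_distributions F1 F2].

Lemma ubsr_has_inf (d : measure_display) (T : measurableType d)
    (R : realType) (P : probability T R) (l : R -> R) (K k alpha : R)
    (X : {RV P >-> R}) :
  nondecreasing_fun l -> 0 < K -> 0 < k -> K.-lipschitz l ->
  (forall x1 x2 : R, x1 <= x2 -> l x1 + k * (x2 - x1) <= l x2) ->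
  P.-integrable setT (EFin \o X) ->
  has_inf [set xi : R | ('E_P[fun w => l (X w - xi)%R] <= alpha%:E)%E].
Proof.
move=> lnd K0 k0 lip gr Xint.
have il xi : P.-integrable setT (fun w => (l (X w - xi))%:E).
  have : P.-integrable setT
      (fun w => (`|l 0| + K * `|xi|)%:E + K%:E * `|(X w)%:E|)%E.
    apply: integrableD => //.
      exact: finite_measure_integrable_cst.
    by apply: integrableZl => //; exact: integrable_abse.
  apply: le_integrable => //.
    apply/measurable_EFinP; apply: (measurableT_comp (f := l)).
      exact: nondecreasing_measurable.
    exact: measurable_funB.
  move=> w _; rewrite -EFinM -EFinD !abse_EFin lee_fin.
  apply: le_trans (ler_norm _).
  have := lip (X w - xi, 0); rewrite /= => /(_ (conj I I)); rewrite subr0 => H.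
  rewrite -[l (X w - xi)%R](subrK (l 0)) addrC.
  apply: (le_trans (ler_normD _ _)); rewrite -addrA lerD2l.
  apply: (le_trans H); rewrite -mulrDr ler_pM2l// [`|xi| + _]addrC.
  exact: ler_normB.
have iC (c : R) : P.-integrable setT (fun=> c%:E : \bar R).
  exact: finite_measure_integrable_cst.
pose m := fine ('E_P[fun w => l (X w - 0)%R])%E.
have Em : ('E_P[fun w => l (X w - 0)%R] = m%:E)%E.
  by rewrite /m fineK// unlock; apply: integrable_fin_num.
have Ec (c : R) : ('E_P[fun w => (l (X w - 0) + c)%R] = (m + c)%:E)%E.
  rewrite unlock.
  transitivity (\int[P]_w ((l (X w - 0))%:E + c%:E))%E; first by [].
  rewrite integralD// EFinD; congr (_ + _)%E; first by rewrite -Em unlock.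
  by have := expectation_cst P c; rewrite unlock.
have hp xi : 0 <= xi -> ('E_P[fun w => l (X w - xi)%R] <= (m - k * xi)%:E)%E.
  move=> xi0; rewrite -Ec unlock; apply: le_integral => //.
    exact: (integrableD _ (il 0) (iC _)).
  move=> w _; rewrite lee_fin lerBrDr.
  have := gr (X w - xi) (X w - 0); rewrite subr0 opprB addrCA subrr addr0.
  by apply; rewrite lerBlDr lerDl.
have hn xi : xi <= 0 -> ((m - k * xi)%:E <= 'E_P[fun w => l (X w - xi)%R])%E.
  move=> xi0; rewrite -Ec unlock; apply: le_integral => //.
    exact: (integrableD _ (il 0) (iC _)).
  move=> w _; rewrite lee_fin.
  have := gr (X w - 0) (X w - xi).
  rewrite subr0 [X w - xi]addrC addrK mulrN; apply.
  by rewrite lerDr oppr_ge0.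
split.
  exists (Num.max 0 ((m - alpha) / k)) => /=.
  have x0 : 0 <= Num.max 0 ((m - alpha) / k) by rewrite le_max lexx.
  apply: (le_trans (hp _ x0)); rewrite lee_fin lerBlDr -lerBlDl.
  by rewrite [k * _]mulrC -ler_pdivrMr// le_max lexx orbT.
exists (Num.min 0 ((m - alpha) / k)) => xi /= H.
have [x0|x0] := ltP 0 xi; first by rewrite ge_min (ltW x0).
have := le_trans (hn _ x0) H.
rewrite lee_fin lerBlDr -lerBlDl [k * _]mulrC -ler_pdivrMr// => {}H.
by rewrite ge_min H orbT.
Qed.

(* Main.v *)
(** Fix a coupling [pi] of finite cost [c] and put [e = K c / k]. Growth and the
    Lipschitz property give
    [l (y - xi - e) <= l (y - xi) - k e <= l (x - xi) + (K |x - y| - K c)],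
    and the bracket has [pi]-mean zero. So adding [e] maps the acceptance set of
    [X] into that of [Y], and vice versa by symmetry; hence their infima differ
    by at most [e]. No integrability of [X] or [Y] is available: the mean
    inequality also covers the conventions for non-integrable functions, where
    the integral is [\int f^+ - \int f^-] with [+oo - +oo = -oo]. *)

Require Import Defs.
From HB Require Import structures.
From mathcomp Require Import all_boot all_order all_algebra.
From mathcomp Require Import all_classical all_reals all_analysis.
From mathcomp Require Import measurable_realfun.

Import Order.TTheory GRing.Theory Num.Theory.
Import numFieldNormedType.Exports.

Local Open Scope classical_set_scope.
Local Open Scope ring_scope.

(** The rays are closed under intersection, generate the Borel sets, and those with natural
    endpoints cover the line with finite measure, so uniqueness of measures applies. This turns
    equality of CDFs into equality of laws. *)
Lemma eq_measure_of_rays (R : realType) (m1 m2 : {measure set R -> \bar R}) :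
  (forall x : R, m1 `]-oo, x]%classic = m2 `]-oo, x]%classic) ->
  (forall x : R, m1 `]-oo, x]%classic < +oo)%E ->
  forall A, measurable A -> m1 A = m2 A.
Proof.
move=> m12 m1oo; pose G := [set `]-oo, x]%classic | x in [set: R]].
apply: (measure_unique G (fun n => `]-oo, n%:R]%classic)) => //.
- rewrite eqEsubset; split => A.
    apply: smallest_sub; first exact: smallest_sigma_algebra.
    move=> _ [[a b] _ <-]; rewrite /=.
    (* The half-open intervals generating the Borel sets are differences of rays. *)
    have -> : `]a, b]%classic = `]-oo, b] `\` `]-oo, a].
      by rewrite -[RHS]setCK setCD setCitvl setUC -[LHS]setCK setCitv.
    by apply: (@measurableD _ (g_sigma_algebraType G));
      apply: sub_sigma_algebra; eexists.
  apply: smallest_sub; first exact: sigma_algebra_measurable.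
  by move=> _ [x _ <-]; exact: measurable_itv.
- move=> _ _ [x _ <-] [y _ <-]; exists (Num.min x y) => //.
  by apply/seteqP; split => z /=; rewrite !in_itv/= le_min => /andP.
- by move=> i; exists i%:R.
- rewrite -subTset => x _; exists (Num.bound `|x|) => //=.
  by rewrite in_itv/= (le_trans (ler_norm x))// ltW// archi_boundP.
- by move=> _ [x _ <-].
Qed.

(** Change of variables holds separately for the positive and negative parts, so it survives the
    convention for [+oo - +oo]. *)
Lemma integral_pushforward_measurable {d1 d2} {X : measurableType d1}
    {Y : measurableType d2} {R : realType} (mu : {measure set X -> \bar R})
    {phi : X -> Y} {f : Y -> \bar R} :
  measurable_fun setT phi -> measurable_fun setT f ->
  (\int[pushforward mu phi]_y f y = \int[mu]_x f (phi x))%E.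
Proof.
move=> mphi mf; rewrite [LHS]integralE [RHS]integralE.
rewrite (ge0_integral_pushforward mphi mu measurableT (measurable_funepos mf))//.
rewrite (ge0_integral_pushforward mphi mu measurableT (measurable_funeneg mf))//.
rewrite preimage_setT; congr (_ - _)%E; apply: eq_integral => x _.
  by rewrite -funepos_comp.
by rewrite -funeneg_comp.
Qed.

Lemma le_integral_measurable d (T : measurableType d) (R : realType)
    (mu : {measure set T -> \bar R}) (f g : T -> \bar R) :
  measurable_fun setT f -> measurable_fun setT g -> (forall x, f x <= g x)%E ->
  (\int[mu]_x f x <= \int[mu]_x g x)%E.
Proof.
move=> mf mg fg; rewrite integralE [leRHS]integralE leeB//.
  apply: ge0_le_integral => //; [exact: measurable_funepos..|].
  by move=> x /mem_set; apply: funepos_le => y _; exact: fg.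
apply: ge0_le_integral => //; [exact: measurable_funeneg..|].
by move=> x /mem_set; apply: funeneg_le => y _; exact: fg.
Qed.

(** Three cases: if the negative part of [f] has infinite integral, the left side is [-oo]; if only
    the positive part does, the right side is [+oo]; otherwise [f] is integrable and equality
    holds. *)
Lemma le_integralD {d} {T : measurableType d} {R : realType}
    {mu : {measure set T -> \bar R}} {f g : T -> R} :
  measurable_fun setT f -> mu.-integrable setT (EFin \o g) ->
  (\int[mu]_x (f x + g x)%:E <= \int[mu]_x (f x)%:E + \int[mu]_x (g x)%:E)%E.
Proof.
move=> mf ig.
have mEf : measurable_fun setT (EFin \o f) by exact/measurable_EFinP.
have mEg : measurable_fun setT (EFin \o g) by exact: measurable_int ig.
have mg : measurable_fun setT g by exact/measurable_EFinP.
pose h := EFin \o (f \+ g).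
have mh : measurable_fun setT h.
  by apply/measurable_EFinP; exact: measurable_funD.
have gfin : (\int[mu]_x (g x)%:E)%E \is a fin_num by exact: integrable_fin_num.
have iag : (\int[mu]_x `|(g x)%:E| < +oo)%E by case/integrableP : ig.
have [fneg|fneg] := eqVneq (\int[mu]_x (EFin \o f)^\- x)%E +oo%E.
  rewrite [leLHS]integralE.
  suff -> : (\int[mu]_x (h^\- x) = +oo)%E by rewrite addeC leNye.
  (* Since [f^- <= (f + g)^- + |g|] and [|g|] has finite integral, the integral of [(f + g)^-] must
     be infinite. *)
  have : (\int[mu]_x (EFin \o f)^\- x <=
          \int[mu]_x (h^\- x + `|(g x)%:E|))%E.
    apply: ge0_le_integral => //.
    - exact: measurable_funeneg.
    - by apply: emeasurable_funD; [exact: measurable_funeneg|exact: measurableT_comp].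
    - move=> x _; rewrite !funenegE /= -!EFin_max -EFinD lee_fin.
      rewrite ge_max; apply/andP; split.
        rewrite -lerBlDr le_max; apply/orP; left; rewrite lerBlDr opprD -addrA lerDl.
        by rewrite addrC subr_ge0 ler_norm.
      by rewrite addr_ge0// le_max lexx orbT.
  rewrite fneg ge0_integralD//; [|exact: measurable_funeneg|exact: measurableT_comp].
  move: iag; case: (\int[mu]_x `|(g x)%:E|)%E => [r|//|] _.
    by case: (\int[mu]_x _)%E.
  by case: (\int[mu]_x _)%E.
have [fpos|fpos] := eqVneq (\int[mu]_x (EFin \o f)^\+ x)%E +oo%E.
  rewrite [X in (_ <= X + _)%E]integralE fpos.
  have : (0 <= \int[mu]_x (EFin \o f)^\- x)%E by apply: integral_ge0.
  move: fneg; case: (\int[mu]_x (EFin \o f)^\- x)%E => //= r _ _.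
  by move: gfin; case: (\int[mu]_x (g x)%:E)%E => //= s _; rewrite leey.
have if_ : mu.-integrable setT (EFin \o f).
  apply/integrableP; split => //.
  under eq_integral do rewrite -/((abse \o (EFin \o f)) _) fune_abse.
  rewrite ge0_integralD//; [|exact: measurable_funepos|exact: measurable_funeneg].
  by rewrite lte_add_pinfty// ltey.
by rewrite -integralD.
Qed.

(* If one set has no infimum, then neither has the other, and both [inf]s take
   the default value 0. *)
Lemma dist_inf_le (R : realType) (A B : set R) (e : R) : 0 <= e ->
  (forall x, A x -> B (x + e)) -> (forall x, B x -> A (x + e)) ->
  `|inf A - inf B| <= e.
Proof.
move=> e0.
(* One-sided form, to be used in both directions: the shift from [V] to [U] carries lower bounds of
   [U] over to [V], the shift from [U] to [V] compares the infima. *)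
have H (U V : set R) : (forall x, U x -> V (x + e)) ->
    (forall x, V x -> U (x + e)) -> has_inf U -> has_inf V /\ inf V <= inf U + e.
  move=> UV VU [[u Uu] lU].
  have hV : has_inf V.
    split; first by exists (u + e); exact: UV.
    case: lU => b bU; exists (b - e) => v Vv.
    by rewrite lerBlDr; apply: bU; exact: VU.
  split=> //; rewrite -lerBlDr; apply: lb_le_inf; first by exists u.
  by move=> x Ux; rewrite lerBlDr; apply: ge_inf; [exact: hV.2|exact: UV].
move=> AB BA; have [hA|nA] := pselect (has_inf A).
  have [hB BAe] := H _ _ AB BA hA; have [_ ABe] := H _ _ BA AB hB.
  by rewrite ler_distl ABe lerBlDr BAe.
have nB : ~ has_inf B by move=> /(H _ _ BA AB) [].
by rewrite !inf_out// subrr normr0.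
Qed.

(** Both sides integrate [f] against a law on the real line, that of [X] and that of [Z]; these
    agree on rays, hence everywhere. *)
Lemma expectation_coupling {d} {T : measurableType d} {R : realType}
    {P : probability T R} (X : {RV P >-> R}) {d'} {S : measurableType d'}
    (pi : probability S R) (Z : S -> R) (f : R -> R) :
  measurable_fun setT Z -> measurable_fun setT f ->
  (forall x : R, pi (Z @^-1` `]-oo, x]) = cdf X x) ->
  ('E_P[fun w => f (X w)] = \int[pi]_z (f (Z z))%:E)%E.
Proof.
move=> mZ mf ZX; rewrite unlock.
have mEf : measurable_fun setT (EFin \o f) by exact/measurable_EFinP.
have mX : measurable_fun setT X by exact: measurable_funPT.
rewrite -[LHS](integral_pushforward_measurable P mX mEf).
rewrite -[RHS](integral_pushforward_measurable pi mZ mEf).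
apply: eq_measure_integral => A mA _; apply: eq_measure_of_rays => // x.
  by rewrite -[LHS]/(cdf X x) -ZX.
by rewrite -[ltLHS]/(cdf X x) (le_lt_trans (cdf_le1 X x))// ltry.
Qed.

(** Stated for arbitrary [U] and [V], so that exchanging the two projections of a coupling gives
    both directions. *)
Lemma shortfall_shift d (S : measurableType d) (R : realType)
    (pi : probability S R) (l : R -> R) (K k alpha c : R) (U V : S -> R) (xi : R) :
  0 < K -> 0 < k -> measurable_fun setT l -> K.-lipschitz l ->
  (forall x1 x2 : R, x1 <= x2 -> l x1 + k * (x2 - x1) <= l x2) ->
  measurable_fun setT U -> measurable_fun setT V ->
  (\int[pi]_z (`|U z - V z|)%:E = c%:E)%E ->
  (\int[pi]_z (l (U z - xi))%:E <= alpha%:E)%E ->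
  (\int[pi]_z (l (V z - (xi + K / k * c)))%:E <= alpha%:E)%E.
Proof.
move=> K0 k0 ml lip gr mU mV cE lU.
have c0 : 0 <= c by rewrite -lee_fin -cE integral_ge0.
have mUV : measurable_fun setT (fun z => `|U z - V z|).
  by apply: measurableT_comp => //; exact: measurable_funB.
have mlW (W : S -> R) a : measurable_fun setT W -> measurable_fun setT (fun z : S => l (W z - a)).
  by move=> mW; apply: (measurableT_comp ml); exact: measurable_funB.
have iUV : pi.-integrable setT (fun z => (`|U z - V z|)%:E).
  apply/integrableP; split; first exact/measurable_EFinP.
  by under eq_integral do rewrite /= normr_id; rewrite cE ltey.
have iC (r : R) : pi.-integrable setT (fun=> r%:E : \bar R).
  exact: finite_measure_integrable_cst.
(* The Lipschitz error, centred by its mean [K * c]. *)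
pose g z := K * `|U z - V z| - K * c.
have ig : pi.-integrable setT (EFin \o g).
  have := integrableD measurableT (integrableZl measurableT K iUV) (iC (- (K * c))).
  exact.
have g0 : (\int[pi]_z (g z)%:E = 0)%E.
  transitivity (\int[pi]_z (K%:E * (`|U z - V z|)%:E + (- (K * c))%:E))%E => //.
  rewrite integralD//; last exact: integrableZl.
  rewrite integralZl// cE integral_cst//= [X in (_ + _ * X)%E]probability_setT mule1.
  by rewrite -EFinM -EFinD subrr.
(* Adding the mean of [g] changes nothing, and subadditivity reduces the claim to a pointwise
   inequality. *)
apply: le_trans lU; rewrite -[leRHS]adde0 -g0.
apply: le_trans (le_integralD (mlW _ _ mU) ig).
apply: le_integral_measurable.
- by apply/measurable_EFinP; exact: mlW.
- apply/measurable_EFinP; apply: measurable_funD; first exact: mlW.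
  by apply/measurable_EFinP; exact: measurable_int ig.
move=> z; rewrite lee_fin /g.
have e0 : 0 <= K / k * c by rewrite mulr_ge0// divr_ge0// ltW.
(* By growth, the shift lowers [l] by at least [k * (K / k * c) = K * c], exactly the constant
   subtracted in [g]. *)
have := gr (V z - (xi + K / k * c)) (V z - xi).
rewrite lerD2l lerN2 lerDl => /(_ e0).
have -> : V z - xi - (V z - (xi + K / k * c)) = K / k * c.
  by rewrite !opprD !opprK addrACA subrr add0r addrA addNr add0r.
rewrite mulrA mulrCA divff ?gt_eqF// mulr1 -lerBrDr => /le_trans; apply.
rewrite addrA lerD2r -lerBlDl.
apply: (le_trans (ler_norm _)).
have := lip (V z - xi, U z - xi) (conj I I) => /= /le_trans; apply.
rewrite ler_pM2l//.
have -> : V z - xi - (U z - xi) = V z - U z.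
  by rewrite opprB addrA subrK.
by rewrite distrC.
Qed.

Theorem lemma15 (R : realType)
    (d : measure_display) (T : measurableType d) (P : probability T R)
    (d' : measure_display) (T' : measurableType d') (P' : probability T' R)
    (l : R -> R) (K k alpha : R) (X : {RV P >-> R}) (Y : {RV P' >-> R})
    (l_nondecreasing : nondecreasing_fun l)
    (K_gt0 : 0 < K) (k_gt0 : 0 < k)
    (l_lipschitz : K.-lipschitz l)
    (l_growth : forall x1 x2 : R, x1 <= x2 -> l x1 + k * (x2 - x1) <= l x2) :
  ((`|ubsr l alpha X - ubsr l alpha Y|)%:E
     <= (K / k)%:E * wasserstein1 (cdf X) (cdf Y))%E.
Proof.
have Kk : 0 < K / k by rewrite divr_gt0.
have ml : measurable_fun setT l by exact: nondecreasing_measurable.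
rewrite -lee_pdivrMl//; apply: le_ereal_inf_tmp => _ [pi [piX piY] <-].
have : (0 <= \int[pi]_z (`|z.1 - z.2|)%:E)%E by exact: integral_ge0.
(* A coupling of infinite cost gives a trivial bound. *)
case cE : (\int[pi]_z (`|z.1 - z.2|)%:E)%E => [c| |]//; last by move=> _; exact: leey.
rewrite lee_fin => c0; rewrite -EFinM lee_fin ler_pdivrMl//.
have mlB (xi : R) : measurable_fun setT (fun x : R => l (x - xi)).
  by apply: (measurableT_comp ml); exact: measurable_funB.
have EX (xi : R) : ('E_P[fun w => l (X w - xi)%R] = \int[pi]_z (l (z.1 - xi))%:E)%E.
  apply: (expectation_coupling X pi fst (fun x => l (x - xi))) => // x.
  by rewrite -piX setXT.
have EY (xi : R) : ('E_P'[fun w => l (Y w - xi)%R] = \int[pi]_z (l (z.2 - xi))%:E)%E.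
  apply: (expectation_coupling Y pi snd (fun x => l (x - xi))) => // x.
  by rewrite -piY setTX.
apply: dist_inf_le => [|xi|xi] /=; first by rewrite mulr_ge0// ltW.
- by rewrite EX EY; apply: shortfall_shift.
- rewrite EX EY; apply: shortfall_shift => //.
  (* The cost is symmetric, so the same [c] serves the reverse shift. *)
  by under eq_integral do rewrite distrC.
Qed.
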